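(* Let $S\in\mathsf{SS}^{\mathrm{ns}}_{\leq n}$, let $M$ be a finite-dimensional left $A_S$-module, let $\nabla$ be a left connection on $M$ with edge transports $R_e\colon M_{d_1(e)}\to M_{d_0(e)}$ ($e\in S_1$), and let $\sigma=[v_0,v_1,v_2]\in S_2$. Write $e_{01}^\sigma:=d_2\sigma$, $e_{02}^\sigma:=d_1\sigma$, $e_{12}^\sigma:=d_0\sigma$, and for $0\le i<j\le2$ set $R_{ij}^\sigma:=R_{e_{ij}^\sigma}\colon M_{v_i}\to M_{v_j}$. Then the $\sigma$-component of the curvature is $$(K_\nabla)_\sigma=R_{02}^\sigma-R_{12}^\sigma R_{01}^\sigma\colon M_{v_0}\to M_{v_2}.$$ Equivalently, for all $x\in M$, $$K_\nabla(x)=\sum_{\sigma=[v_0,v_1,v_2]\in S_2}\rho_\sigma\otimes\bigl(R_{02}^\sigma-R_{12}^\sigma R_{01}^\sigma\bigr)(\delta_{v_0}x).$$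
   Context: $\Bbbk$ is a field of characteristic different from $2$. $\mathsf{SS}^{\mathrm{ns}}_{\leq n}$ is the category of $n$-truncated semisimplicial sets $S$ with finitely many simplices such that every simplex is determined by its ordered tuple of vertices and every positive-dimensional simplex has pairwise distinct vertices. $[v_0,\dots,v_p]$ is the simplex with ordered vertices $v_0,\dots,v_p$; $d_j$ deletes $v_j$; an edge $e$ goes from $d_1(e)$ to $d_0(e)$. $\Omega_S^\bullet$ is the DGA with $\Omega_S^p$ having basis $\{\rho_\sigma\}_{\sigma\in S_p}$ ($\Omega_S^p=0$ for $p>n$); $\Omega_S^0=A_S=\Bbbk(S_0)$ with $\rho_{[v]}=\delta_v$ the indicator idempotents; $\omega_e:=\rho_e$ for edges. The product is $\rho_{[v_0,\dots,v_p]}\wedge\rho_{[w_0,\dots,w_q]}=\rho_{[v_0,\dots,v_p,w_1,\dots,w_q]}$ if $v_p=w_0$ and the latter tuple is a simplex of $S$, and $0$ otherwise; $d\rho_\sigma=\sum_{j=0}^{p+1}(-1)^j\sum_{\tau\in S_{p+1},d_j\tau=\sigma}\rho_\tau$. For a left $A_S$-module $M$, $M_v:=\delta_vM$. A left connection is a $\Bbbk$-linear $\nabla\colon M\to\Omega_S^1\otimes_{A_S}M$ with $\nabla(fx)=df\otimes x+f\nabla(x)$. Every left connection has a unique expression $\nabla(x)=\sum_{e\in S_1}\omega_e\otimes(\delta_{d_0(e)}x-R_e(\delta_{d_1(e)}x))$ with $R_e\in\operatorname{Hom}_\Bbbk(M_{d_1(e)},M_{d_0(e)})$; the $R_e$ are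 its edge transports. $\nabla$ extends to $\widehat\nabla(\alpha\otimes x)=d\alpha\otimes x+(-1)^{|\alpha|}\alpha\wedge\nabla(x)$ on $\Omega_S^\bullet\otimes_{A_S}M$, and the curvature is $K_\nabla:=\widehat\nabla^2|_M\colon M\to\Omega_S^2\otimes_{A_S}M$, a left $A_S$-linear map. Left $A_S$-linear maps $M\to\Omega_S^2\otimes_{A_S}M$ correspond bijectively to families $(U_\sigma\colon M_{v_0}\to M_{v_2})_{\sigma=[v_0,v_1,v_2]\in S_2}$ of linear maps via $x\mapsto\sum_\sigma\rho_\sigma\otimes U_\sigma(\delta_{v_0}x)$; $(K_\nabla)_\sigma$ is the $\sigma$-member of the family of $K_\nabla$. *)

(* Defs.v *)
From HB Require Import structures.
From mathcomp Require Import all_boot all_order all_algebra.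
From mathcomp Require Import generic_quotient ring_quotient boolp.
From mathcomp.multinomials Require Import freeg.

Set Implicit Arguments.
Unset Strict Implicit.
Unset Printing Implicit Defensive.

Import GRing.Theory.
Local Open Scope ring_scope.
Local Open Scope quotient_scope.

(* ------------------------------------------------------------------------ *)
(* Tensor product of a right A-module N (a left module over the converse    *)
(* ring A^c) and a left A-module M: the free abelian group on N * M modulo  *)
(* the subgroup generated by the biadditivity and balancing relations.      *)
(* ------------------------------------------------------------------------ *)
Section Tensor.
Variables (A : pzRingType) (N : lmodType A^c) (M : lmodType A).

Local Notation F := {freeg (N * M)%type}.

Definition rmul (a : N) (f : A) : N := (f : A^c) *: a.

Inductive tensor_rel : F -> Prop :=
| TensorRel0 : tensor_rel 0
| TensorRelB u v : tensor_rel u -> tensor_rel v -> tensor_rel (u - v)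
| TensorRelDl a b x :
    tensor_rel (<< (a + b, x) >> - << (a, x) >> - << (b, x) >>)
| TensorRelDr a x y :
    tensor_rel (<< (a, x + y) >> - << (a, x) >> - << (a, y) >>)
| TensorRelM a f x : tensor_rel (<< (rmul a f, x) >> - << (a, f *: x) >>).

Definition tensor_pred : {pred F} := fun u => `[< tensor_rel u >].

Fact tensor_zmod_closed : zmod_closed tensor_pred.
Proof.
split; first exact/asboolP/TensorRel0.
by move=> u v /asboolP uI /asboolP vI; apply/asboolP/TensorRelB.
Qed.

HB.instance Definition _ :=
  GRing.isZmodClosed.Build F tensor_pred tensor_zmod_closed.

Definition tensor := Quotient.quot tensor_pred.
HB.instance Definition _ := GRing.Zmodule.on tensor.

Definition tpure (a : N) (x : M) : tensor := \pi_(Quotient.quot tensor_pred) << (a, x) >>.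

(* The additive map out of the tensor product determined by a biadditive    *)
(* balanced g (see tlift_pure).                                             *)
Definition tlift (V : zmodType) (g : N -> M -> V) (t : tensor) : V :=
  fglift (fun ax => g ax.1 ax.2 : zmodule V) (repr t).





Lemma tpi_eq (u v : F) : tensor_rel (u - v) ->
  \pi_(Quotient.quot tensor_pred) u = \pi_(Quotient.quot tensor_pred) v :> tensor.
Proof. by move=> uv; apply/eqP; rewrite -Quotient.idealrBE; apply/asboolP. Qed.

Lemma tpureDl a b x : tpure (a + b) x = tpure a x + tpure b x.
Proof.
rewrite /tpure -[RHS](raddfD (\pi_(Quotient.quot tensor_pred))).
by apply: tpi_eq; rewrite opprD addrA; apply: TensorRelDl.
Qed.

Lemma tpureDr a x y : tpure a (x + y) = tpure a x + tpure a y.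
Proof.
rewrite /tpure -[RHS](raddfD (\pi_(Quotient.quot tensor_pred))).
by apply: tpi_eq; rewrite opprD addrA; apply: TensorRelDr.
Qed.

Lemma tpureM a f x : tpure (rmul a f) x = tpure a (f *: x).
Proof. by apply: tpi_eq; apply: TensorRelM. Qed.
Section Lift.
Variables (V : zmodType) (g : N -> M -> V).
Hypotheses (gDl : forall x, {morph g^~ x : a b / a + b})
           (gDr : forall a, {morph g a : x y / x + y})
           (gM : forall a f x, g (rmul a f) x = g a (f *: x)).

Let G : F -> zmodule V := fglift (fun ax => g ax.1 ax.2 : zmodule V).

Let GU ax : G << ax >> = g ax.1 ax.2.
Proof. by rewrite /G liftU scale1r. Qed.

Let GB u v : G (u - v) = G u - G v.
Proof. exact: lift_is_additive. Qed.

Let G_rel u : tensor_rel u -> G u = 0.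
Proof.
elim=> [|{}u v _ Gu _ Gv|a b x|a x y|a f x].
- by rewrite -(subrr 0) GB subrr.
- by rewrite GB Gu Gv subrr.
- rewrite !GB !GU /= gDl -addrA -opprD; exact: subrr.
- rewrite !GB !GU /= gDr -addrA -opprD; exact: subrr.
- rewrite !GB !GU /= gM; exact: subrr.
Qed.

Let G_repr (u : F) : tlift g (\pi_(Quotient.quot tensor_pred) u) = G u.
Proof.
apply/eqP; rewrite -subr_eq0; apply/eqP; rewrite /tlift -/G -GB.
apply/G_rel/asboolP; rewrite -[`[< _ >]]/(_ - _ \in tensor_pred).
by rewrite Quotient.idealrBE reprK.
Qed.

Lemma tlift_pure a x : tlift g (tpure a x) = g a x.
Proof. by rewrite G_repr GU. Qed.

Lemma tliftB s t : tlift g (s - t) = tlift g s - tlift g t.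
Proof.
rewrite -[s]reprK -[t]reprK.
rewrite -(raddfB (\pi_(Quotient.quot tensor_pred))) !G_repr; exact: GB.
Qed.
End Lift.

Lemma tensor_ind (P : tensor -> Prop) :
  P 0 -> (forall s t, P s -> P t -> P (s - t)) ->
  (forall a x, P (tpure a x)) -> forall t, P t.
Proof.
move=> P0 PB Pp t.
have PN s : P s -> P (- s) by rewrite -sub0r; apply: PB.
have PD s1 s2 : P s1 -> P s2 -> P (s1 + s2).
  by move=> P1 P2; rewrite -[s2]opprK; apply: PB => //; apply: PN.
have PMn m s : P s -> P (s *+ m).
  by move=> Ps; elim: m => [|m IHm]; rewrite ?mulr0n ?mulrS //; apply: PD.
rewrite -[t]reprK -(freeg_sumE (repr t)) raddf_sum; apply: big_ind => // ax _.
rewrite -[coeff _ _]intz -freegU_mulz raddfMz /=.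
case: ax => a x; case: (coeff _ _) => m; last by apply/PN/PMn/Pp.
exact/PMn/Pp.
Qed.
End Tensor.

(* ------------------------------------------------------------------------ *)
(* Semisimplicial sets                                                      *)
(* ------------------------------------------------------------------------ *)
Section Vertices.
Variables (X : nat -> finType) (d : forall p, 'I_p.+2 -> X p.+1 -> X p).

Fixpoint first_vertex p : X p -> X 0 :=
  if p is p'.+1 then fun s => first_vertex (d ord_max s) else id.

Fixpoint last_vertex p : X p -> X 0 :=
  if p is p'.+1 then fun s => last_vertex (d ord0 s) else id.

(* The ordered tuple of vertices of a p-simplex (of size p.+1): its first   *)
(* vertex followed by the vertices of d_0 s.                                *)
Fixpoint vertices p : X p -> seq (X 0) :=
  if p is p'.+1 then fun s => first_vertex s :: vertices (d ord0 s)
  else fun v => [:: v].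
End Vertices.

(* The objects of SS^ns_{<= n}. An n-truncated semisimplicial set is encoded *)
(* as a semisimplicial set without simplices of dimension > n; [face_face] is *)
(* the identity d_i d_{j+1} = d_j d_i for i <= j.                            *)
Record ssns (n : nat) := SSns {
  simp : nat -> finType;
  face : forall p, 'I_p.+2 -> simp p.+1 -> simp p;
  face_face : forall p (i j : 'I_p.+2) (s : simp p.+2), (i <= j)%N ->
    face i (face (fintype.lift ord0 j) s) = face j (face (widen_ord (leqnSn _) i) s);
  simp_trunc : forall p, (n < p)%N -> #|simp p| = 0%N;
  vertices_inj : forall p, injective (@vertices simp (@face) p);
  vertices_uniq : forall p (s : simp p), uniq (vertices (@face) s)
}.

Arguments face {n} S {p} i s : rename.
Section SimpTheory.
Variables (n : nat) (S : ssns n).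

Definition vfirst p (s : simp S p) := first_vertex (@face n S) s.
Definition vlast p (s : simp S p) := last_vertex (@face n S) s.
Definition verts p (s : simp S p) := vertices (@face n S) s.

Lemma vertsS p (s : simp S p.+1) :
  verts s = vfirst s :: verts (face S ord0 s).
Proof. by []. Qed.

Lemma size_verts p (s : simp S p) : size (verts s) = p.+1.
Proof. by elim: p s => //= p IHp s; rewrite IHp. Qed.

Lemma head_verts x0 p (s : simp S p) : head x0 (verts s) = vfirst s.
Proof. by case: p s. Qed.

Lemma last_verts x0 p (s : simp S p) : last x0 (verts s) = vlast s.
Proof. by elim: p x0 s => //= p IHp x0 s; apply: IHp. Qed.

Lemma face0S p (j : 'I_p.+2) (s : simp S p.+2) :
  face S ord0 (face S (fintype.lift ord0 j) s) = face S j (face S ord0 s).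
Proof. by rewrite face_face //; congr (face S _ (face S _ _)); apply: val_inj. Qed.

Lemma faceS_max p (j : 'I_p.+2) (s : simp S p.+2) :
  face S j (face S ord_max s) = face S ord_max (face S (widen_ord (leqnSn _) j) s).
Proof.
rewrite -face_face; last exact: leq_ord.
by congr (face S _ (face S _ _)); apply: val_inj.
Qed.

Lemma vfirst_faceS p (j : 'I_p.+1) (s : simp S p.+1) :
  vfirst (face S (fintype.lift ord0 j) s) = vfirst s.
Proof.
elim: p j s => [|p IHp] j s; first by rewrite (_ : fintype.lift _ _ = ord_max) //; apply: val_inj; rewrite /= ord1.
have [j1|nj] := eqVneq (j : nat) p.+1.
  by rewrite (_ : fintype.lift _ _ = ord_max) //; apply: val_inj; rewrite /= j1.
have lj : (j < p.+1)%N by rewrite ltn_neqAle nj -ltnS ltn_ord.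
rewrite -[LHS]/(vfirst (face S ord_max _)) -[RHS]/(vfirst (face S ord_max _)).
rewrite -[RHS](IHp (Ordinal lj)) faceS_max.
by congr (vfirst (face S _ (face S _ _))); apply: val_inj.
Qed.

Lemma vlast_face p (j : 'I_p.+2) (s : simp S p.+1) :
  j != ord_max -> vlast (face S j s) = vlast s.
Proof.
elim: p j s => [|p IHp] j s; case: (unliftP ord0 j) => [j'|] -> // nj.
  by case/negP: nj; apply/eqP/val_inj; rewrite /= ord1.
rewrite -[LHS]/(vlast (face S ord0 _)) face0S -[RHS]/(vlast (face S ord0 _)) IHp //.
Qed.

Lemma verts_max p (s : simp S p.+1) :
  verts s = rcons (verts (face S ord_max s)) (vlast s).
Proof.
elim: p s => [|p IHp] s //.
rewrite -[LHS]/(vfirst s :: verts (face S ord0 s)) IHp.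
rewrite -face0S (_ : fintype.lift ord0 ord_max = ord_max) //; exact: val_inj.
Qed.

(* d_j deletes the j-th vertex. *)
Lemma verts_face p (j : 'I_p.+2) (s : simp S p.+1) :
  verts (face S j s) = take j (verts s) ++ drop j.+1 (verts s).
Proof.
elim: p j s => [|p IHp] j s; case: (unliftP ord0 j) => [j'|] ->.
- by rewrite ord1 (_ : fintype.lift _ _ = ord_max) //; apply: val_inj.
- by rewrite /= ?drop0.
- rewrite -[LHS]/(vfirst _ :: verts (face S ord0 _)) vfirst_faceS face0S IHp.
  by rewrite lift0 (vertsS s).
- by rewrite /= ?drop0.
Qed.

Fixpoint last_edge p : simp S p.+1 -> simp S 1 :=
  if p is p'.+1 then fun s => last_edge (face S ord0 s) else id.

Lemma last_edge_last p (s : simp S p.+1) : vlast (last_edge s) = vlast s.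
Proof. by elim: p s => //= p IHp s; rewrite IHp. Qed.

Lemma last_edge_first p (s : simp S p.+1) :
  vfirst (last_edge s) = vlast (face S ord_max s).
Proof.
elim: p s => //= p IHp s; rewrite IHp -face0S.
rewrite -[RHS]/(vlast (face S ord0 _)).
by congr (vlast (face S _ (face S _ _))); apply: val_inj.
Qed.

(* joins s t u: the vertex tuple of u is that of s followed by that of t,   *)
(* overlapping in the last vertex of s, which is the first vertex of t.     *)
Definition joins p q r (s : simp S p) (t : simp S q) (u : simp S r) : bool :=
  (vlast s == vfirst t) && (verts u == verts s ++ behead (verts t)).

Lemma joins0l q (v : simp S 0) (t u : simp S q) :
  joins v t u = (v == vfirst u) && (t == u).
Proof.
rewrite /joins -/(vlast v) -[vlast v]/v.
have -> : (verts v ++ behead (verts t)) = v :: behead (verts t) by [].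
apply/andP/andP => [[/eqP-> /eqP e]|[/eqP -> /eqP ->]]; last first.
  by case: q {t} u => [|q] u.
have eu : verts u = verts t by rewrite e; case: (q) t {u e}.
by rewrite (vertices_inj eu).
Qed.

Lemma joins0r p (s : simp S p) (v : simp S 0) (u : simp S p) :
  joins s v u = (v == vlast u) && (s == u).
Proof.
rewrite /joins cats0 eq_sym -[vfirst v]/v.
apply/andP/andP => [[/eqP-> /eqP e]|[/eqP -> /eqP ->]] //.
by rewrite (vertices_inj e).
Qed.

Lemma joins1r p (s : simp S p) (e : simp S 1) (u : simp S p.+1) :
  joins s e u = (s == face S ord_max u) && (e == last_edge u).
Proof.
have ve (f : simp S 1) : verts f = [:: vfirst f; vlast f] by [].
have bve (f : simp S 1) : behead (verts f) = [:: vlast f] by [].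
rewrite /joins bve cats1 verts_max eqseq_rcons.
apply/and3P/andP => [[/eqP ls /eqP/vertices_inj us /eqP lu]|[/eqP -> /eqP ->]].
  split; first by rewrite us.
  apply/eqP/vertices_inj; rewrite -/(verts e) -/(verts (last_edge u)) !ve last_edge_first.
  by rewrite last_edge_last us ls lu.
by rewrite last_edge_first last_edge_last !eqxx.
Qed.

End SimpTheory.

(* ------------------------------------------------------------------------ *)
(* The differential graded algebra of S                                     *)
(* ------------------------------------------------------------------------ *)
Section Forms.
Variables (k : fieldType) (n : nat) (S : ssns n).

(* A_S = k(S_0), with the pointwise operations *)
Definition vertex_alg : pzRingType := {ffun simp S 0 -> k}.
Local Notation A := vertex_alg.

Definition Omega (p : nat) : Type := {ffun simp S p -> k}.
HB.instance Definition _ p := GRing.Zmodule.copy (Omega p) {ffun simp S p -> k}.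

Definition rho p (s : simp S p) : Omega p := [ffun t => (t == s)%:R].

(* The product Omega^p x Omega^q -> Omega^r; by the size of the vertex      *)
(* tuples it is meaningful for r = p + q only. Leaving r free spares casts  *)
(* along equalities such as p + 0 = p and p + 1 = p.+1.                     *)
Definition wedge p q r (a : Omega p) (b : Omega q) : Omega r :=
  [ffun u => \sum_(s : simp S p) \sum_(t : simp S q | joins s t u) a s * b t].

Definition diff p (a : Omega p) : Omega p.+1 :=
  [ffun u => \sum_(j < p.+2) (-1) ^+ j * a (face S j u)].

Lemma wedge_rho p q r (s : simp S p) (t : simp S q) :
  wedge r (rho s) (rho t) = \sum_(u | joins s t u) rho u.
Proof.
apply/ffunP => u; rewrite sum_ffunE ffunE (bigD1 s) //= [X in _ + X]big1.
  rewrite addr0 big_mkcond (bigD1 t) //= [X in _ + X]big1.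
    rewrite addr0 !ffunE !eqxx mulr1 [RHS]big_mkcond (bigD1 u) //=.
    rewrite ffunE eqxx big1 ?addr0 // => u' nu.
    by rewrite ffunE eq_sym (negPf nu) if_same.
  by move=> t' nt; rewrite !ffunE (negPf nt) mulr0 if_same.
by move=> s' ns; rewrite big1 // => t' _; rewrite ffunE (negPf ns) mul0r.
Qed.

Lemma diff_rho p (s : simp S p) :
  diff (rho s) =
  \sum_(j < p.+2) \sum_(u | face S j u == s) [ffun v => (-1) ^+ j * rho u v].
Proof.
apply/ffunP => u; rewrite sum_ffunE ffunE; apply: eq_bigr => j _.
rewrite sum_ffunE big_mkcond (bigD1 u) //= !ffunE eqxx mulr1 big1 ?addr0.
  by case: ifP; rewrite ?mulr1 ?mulr0.
by move=> v nv; rewrite !ffunE (eq_sym u) (negPf nv) mulr0 if_same.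
Qed.

Lemma wedge0lE p (f : A) (a : Omega p) u :
  wedge p (f : Omega 0) a u = f (vfirst u) * a u.
Proof.
rewrite ffunE (bigD1 (vfirst u)) //= [X in _ + X]big1; last first.
  by move=> v nv; apply: big_pred0 => t; rewrite joins0l (negPf nv).
rewrite addr0 big_mkcond (bigD1 u) //= joins0l !eqxx big1 ?addr0 // => t nt.
by rewrite joins0l (negPf nt) andbF.
Qed.

Lemma wedge0rE p (a : Omega p) (f : A) u :
  wedge p a (f : Omega 0) u = a u * f (vlast u).
Proof.
rewrite ffunE (bigD1 u) //= [X in _ + X]big1; last first.
  by move=> s ns; apply: big_pred0 => t; rewrite joins0r (negPf ns) andbF.
rewrite addr0 big_mkcond (bigD1 (vlast u)) //= joins0r !eqxx big1 ?addr0 //.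
by move=> t nt; rewrite joins0r (negPf nt).
Qed.

Lemma wedge1rE p (a : Omega p) (b : Omega 1) u :
  wedge p.+1 a b u = a (face S ord_max u) * b (last_edge u).
Proof.
rewrite ffunE (bigD1 (face S ord_max u)) //= [X in _ + X]big1; last first.
  by move=> s ns; apply: big_pred0 => t; rewrite joins1r (negPf ns).
rewrite addr0 big_mkcond (bigD1 (last_edge u)) //= joins1r !eqxx big1 ?addr0 //.
by move=> t nt; rewrite joins1r (negPf nt) andbF.
Qed.

Lemma wedgeDl p q r (a a' : Omega p) (b : Omega q) :
  wedge r (a + a') b = wedge r a b + wedge r a' b.
Proof.
apply/ffunP => u; rewrite !ffunE -big_split; apply: eq_bigr => s _.
by rewrite -big_split; apply: eq_bigr => t _; rewrite ffunE mulrDl.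
Qed.

Lemma wedgeDr p q r (a : Omega p) (b b' : Omega q) :
  wedge r a (b + b') = wedge r a b + wedge r a b'.
Proof.
apply/ffunP => u; rewrite !ffunE -big_split; apply: eq_bigr => s _.
by rewrite -big_split; apply: eq_bigr => t _; rewrite ffunE mulrDr.
Qed.

Lemma diffD p (a b : Omega p) : diff (a + b) = diff a + diff b.
Proof.
apply/ffunP => u; rewrite !ffunE -big_split; apply: eq_bigr => j _.
by rewrite ffunE mulrDr.
Qed.

(* In degree 0 the wedge product is the product of A_S. *)
Lemma wedge00 (f g : A) : wedge 0 (f : Omega 0) (g : Omega 0) = (f * g : A).
Proof. by apply/ffunP => u; rewrite wedge0lE ffunE. Qed.

Lemma wedge_mid p q r (a : Omega p) (f : A) (b : Omega q) :
  wedge r (wedge p a (f : Omega 0)) b = wedge r a (wedge q (f : Omega 0) b).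
Proof.
apply/ffunP => u; rewrite [LHS]ffunE [RHS]ffunE; apply: eq_bigr => s _.
apply: eq_bigr => t /andP[/eqP st _].
by rewrite wedge0lE wedge0rE st mulrA.
Qed.

Lemma wedge_left p q r (f : A) (a : Omega p) (b : Omega q) :
  wedge r (wedge p (f : Omega 0) a) b = wedge r (f : Omega 0) (wedge r a b).
Proof.
apply/ffunP => u; rewrite [RHS]wedge0lE !ffunE mulr_sumr; apply: eq_bigr => s _.
rewrite mulr_sumr; apply: eq_bigr => t /andP[_ /eqP st].
have <- : vfirst s = vfirst u.
  move: (head_verts (vfirst s) s) (size_verts s).
  by rewrite -(head_verts (vfirst s) u) st; case: (verts s).
by rewrite wedge0lE mulrA.
Qed.

Lemma wedge_right p q r (a : Omega p) (b : Omega q) (f : A) :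
  wedge r a (wedge q b (f : Omega 0)) = wedge r (wedge r a b) (f : Omega 0).
Proof.
apply/ffunP => u; rewrite [RHS]wedge0rE !ffunE mulr_suml; apply: eq_bigr => s _.
rewrite mulr_suml; apply: eq_bigr => t /andP[/eqP lf /eqP st].
have <- : vlast t = vlast u.
  rewrite -(last_verts (vlast s) u) st last_cat last_verts lf.
  move: (head_verts (vlast s) t) (last_verts (vlast s) t) (size_verts t).
  by case: (verts t) => //= v c -> ->.
by rewrite wedge0rE mulrA.
Qed.

Lemma diff_wedge0r p (a : Omega p) (f : A) :
  diff (wedge p a (f : Omega 0)) =
  wedge p.+1 (diff a) (f : Omega 0)
  + [ffun u => (-1) ^+ p * wedge p.+1 a (diff (f : Omega 0)) u].
Proof.
apply/ffunP => u; rewrite [RHS]ffunE [in LHS]ffunE wedge0rE [X in _ + X]ffunE.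
rewrite wedge1rE [diff a u]ffunE [diff _ (last_edge u)]ffunE.
rewrite [LHS]big_ord_recr [X in X * _ + _]big_ord_recr /= mulrDl mulr_suml.
rewrite [X in _ * (_ * X)]big_ord_recr big_ord1 /= !expr0 !mul1r !expr1 mulN1r.
rewrite -/(vlast (last_edge u)).
have -> : face S (widen_ord (leqnSn 1) ord0) (last_edge u) = vlast (last_edge u).
  by rewrite /vlast /=; congr (face S _ _); apply: val_inj.
have -> : face S ord_max (last_edge u) = vfirst (last_edge u) by [].
rewrite last_edge_last last_edge_first wedge0rE.
under eq_bigr => j _.
  rewrite wedge0rE vlast_face ?mulrA; last by rewrite neq_ltn /= ltn_ord.
  over.
rewrite -addrA; congr (_ + _).
rewrite -/(vlast u) exprS mulN1r !mulNr !mulrBr !mulrA.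
by rewrite addrA -[in RHS]/(vlast u) addNr add0r.
Qed.

Lemma rho_idem (v : simp S 0) : rho v * rho v = rho v :> A.
Proof. by apply/ffunP => u; rewrite !ffunE; case: eqP => _; rewrite ?mulr1 ?mulr0. Qed.

(* The right A_S-module structure of Omega^p, given by the wedge product *)
Let rscale p (f : A^c) (a : Omega p) : Omega p := wedge p a (f : Omega 0).

Let rscaleA p f g (a : Omega p) : rscale f (rscale g a) = rscale (f * g) a.
Proof. by apply/ffunP => u; rewrite !wedge0rE !ffunE mulrA. Qed.

Let rscale1 p : left_id 1 (@rscale p).
Proof. by move=> a; apply/ffunP => u; rewrite wedge0rE ffunE mulr1. Qed.

Let rscaleDr p : right_distributive (@rscale p) +%R.
Proof. by move=> f a b; apply: wedgeDl. Qed.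

Let rscaleDl p a : {morph (@rscale p)^~ a : f g / f + g}.
Proof. by move=> f g; apply: wedgeDr. Qed.

HB.instance Definition _ p := GRing.Zmodule_isLmodule.Build A^c (Omega p)
  (@rscaleA p) (@rscale1 p) (@rscaleDr p) (@rscaleDl p).

Lemma rmulE p (a : Omega p) (f : A) : rmul a f = wedge p a (f : Omega 0).
Proof. by []. Qed.

End Forms.

(* ------------------------------------------------------------------------ *)
(* Module-valued forms, connections and curvature                           *)
(* ------------------------------------------------------------------------ *)
Section Connections.
Variables (k : fieldType) (n : nat) (S : ssns n).
Local Notation A := (vertex_alg k S).
Local Notation Omega := (Omega k S).
Variable M : lmodType A.

Definition mform (p : nat) : Type := tensor (Omega p) M.
HB.instance Definition _ p := GRing.Zmodule.copy (mform p) (tensor (Omega p) M).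

Definition mpure p (a : Omega p) (x : M) : mform p := tpure a x.

(* a /\ (b (x) x) = (a /\ b) (x) x, with r = p + q *)
Definition mwedge p q r (a : Omega p) (t : mform q) : mform r :=
  tlift (fun (b : Omega q) x => mpure (wedge r a b) x) t.

Section Mwedge.
Variables (p q r : nat) (a : Omega p).
Let g (b : Omega q) x := mpure (wedge r a b) x.
Let gDl x : {morph g^~ x : b b' / b + b'}.
Proof. by move=> b b'; rewrite /g wedgeDr; apply: tpureDl. Qed.
Let gDr b : {morph g b : x y / x + y}.
Proof. by move=> x y; apply: tpureDr. Qed.
Let gM b f x : g (rmul b f) x = g b (f *: x).
Proof. by rewrite /g rmulE wedge_right -rmulE; apply: tpureM. Qed.

Lemma mwedge_pure (b : Omega q) x : mwedge r a (mpure b x) = mpure (wedge r a b) x.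
Proof. exact: tlift_pure. Qed.

Lemma mwedgeB (s t : mform q) : mwedge r a (s - t) = mwedge r a s - mwedge r a t.
Proof. exact: tliftB. Qed.
End Mwedge.

Lemma mwedge0 p q r (a : Omega p) : mwedge r a (0 : mform q) = 0.
Proof. by rewrite -(subrr 0) mwedgeB subrr. Qed.

Lemma mwedgeDr p q r (a : Omega p) (s t : mform q) :
  mwedge r a (s + t) = mwedge r a s + mwedge r a t.
Proof. by rewrite -[t in LHS]opprK mwedgeB -[- t]sub0r mwedgeB mwedge0 sub0r opprK. Qed.

Lemma mwedgeDl p q r (a b : Omega p) (t : mform q) :
  mwedge r (a + b) t = mwedge r a t + mwedge r b t.
Proof.
elim/tensor_ind: t => [|s t IHs IHt|c x]; first by rewrite !mwedge0 addr0.
  by rewrite !mwedgeB IHs IHt opprD addrACA.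
by rewrite !mwedge_pure wedgeDl; apply: tpureDl.
Qed.

Lemma mwedge_mid p q r (a : Omega p) (f : A) (t : mform q) :
  mwedge r (wedge p a (f : Omega 0)) t = mwedge r a (mwedge q (f : Omega 0) t).
Proof.
elim/tensor_ind: t => [|s t IHs IHt|c x]; first by rewrite !mwedge0.
  by rewrite !mwedgeB IHs IHt.
by rewrite !mwedge_pure wedge_mid.
Qed.

Lemma mwedge_left p q r (f : A) (a : Omega p) (t : mform q) :
  mwedge r (wedge p (f : Omega 0) a) t = mwedge r (f : Omega 0) (mwedge r a t).
Proof.
elim/tensor_ind: t => [|s t IHs IHt|c x]; first by rewrite !mwedge0.
  by rewrite !mwedgeB IHs IHt.
by rewrite !mwedge_pure wedge_left.
Qed.

(* The left A_S-module structure of Omega^p (x) M: f (a (x) x) = (f a) (x) x *)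
Let lscale p (f : A) (t : mform p) : mform p := mwedge p (f : Omega 0) t.

Let lscaleA p f g (t : mform p) : lscale f (lscale g t) = lscale (f * g) t.
Proof. by rewrite /lscale -mwedge_left wedge00. Qed.

Let lscale1 p : left_id 1 (@lscale p).
Proof.
move=> t; rewrite /lscale.
elim/tensor_ind: t => [|s t IHs IHt|c x]; first by rewrite mwedge0.
  by rewrite mwedgeB IHs IHt.
rewrite mwedge_pure; congr (mpure _ x).
by apply/ffunP => u; rewrite wedge0lE ffunE mul1r.
Qed.

Let lscaleDr p : right_distributive (@lscale p) +%R.
Proof. by move=> f s t; apply: mwedgeDr. Qed.

Let lscaleDl p t : {morph (@lscale p)^~ t : f g / f + g}.
Proof. by move=> f g; apply: mwedgeDl. Qed.

HB.instance Definition _ p := GRing.Zmodule_isLmodule.Build A (mform p)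
  (@lscaleA p) (@lscale1 p) (@lscaleDr p) (@lscaleDl p).

Lemma mscaleE p (f : A) (t : mform p) : f *: t = mwedge p (f : Omega 0) t.
Proof. by []. Qed.

(* k acts on A_S-modules through the constant functions *)
Definition constf (c : k) : A := [ffun => c].

Definition finite_dimensional : Prop :=
  exists s : seq M, forall x, exists c : nat -> k,
    x = \sum_(i < size s) constf (c i) *: s`_i.

Lemma sign_alg m v : ((-1) ^+ m : A) v = (-1) ^+ m.
Proof. by elim: m => [|m IHm]; rewrite ?ffunE // !exprS !ffunE IHm. Qed.

Record connection := Connection {
  conn :> M -> mform 1;
  conn_klinear : forall c x y,
    conn (constf c *: x + y) = constf c *: conn x + conn y;
  conn_leibniz : forall (f : A) x,
    conn (f *: x) = mpure (diff (f : Omega 0)) x + f *: conn x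
}.

(* The extension of nabla to Omega^p (x) M *)
Definition conn_ext (nabla : connection) p (t : mform p) : mform p.+1 :=
  tlift (fun (a : Omega p) x =>
    mpure (diff a) x + (-1) ^+ p *: mwedge p.+1 a (nabla x)) t.

Section ConnExt.
Variables (nabla : connection) (p : nat).
Let g (a : Omega p) x :=
  mpure (diff a) x + (-1) ^+ p *: mwedge p.+1 a (nabla x).
Let gDl x : {morph g^~ x : b b' / b + b'}.
Proof.
move=> a b; rewrite /g diffD mwedgeDl scalerDr addrACA; congr (_ + _).
exact: tpureDl.
Qed.
Let gDr a : {morph g a : x y / x + y}.
Proof.
move=> x y; rewrite /g.
have -> : nabla (x + y) = nabla x + nabla y.
  have c1 : constf 1 = 1 by apply/ffunP => u; rewrite !ffunE.
  by rewrite -[x in LHS]scale1r -c1 conn_klinear c1 !scale1r.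
rewrite mwedgeDr scalerDr addrACA; congr (_ + _).
exact: tpureDr.
Qed.
Let gM a f x : g (rmul a f) x = g a (f *: x).
Proof.
rewrite /g rmulE conn_leibniz mwedgeDr mwedge_pure mscaleE -mwedge_mid scalerDr.
rewrite addrA; congr (_ + _).
rewrite diff_wedge0r -rmulE [LHS]tpureDl tpureM; congr (_ + _).
rewrite mscaleE mwedge_pure; congr (mpure _ x).
by apply/ffunP => u; rewrite ffunE wedge0lE sign_alg.
Qed.

Lemma conn_ext_pure (a : Omega p) x : conn_ext nabla (mpure a x) =
  mpure (diff a) x + (-1) ^+ p *: mwedge p.+1 a (nabla x).
Proof. exact: tlift_pure. Qed.

Lemma conn_extB (s t : mform p) :
  conn_ext nabla (s - t) = conn_ext nabla s - conn_ext nabla t.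
Proof. exact: tliftB. Qed.
End ConnExt.

(* M is identified with Omega^0 (x) M through x |-> 1 (x) x; under this      *)
(* identification the extension restricts to nabla in degree 0.             *)
Definition curvature (nabla : connection) (x : M) : mform 2 :=
  conn_ext nabla (conn_ext nabla (mpure ((1 : A) : Omega 0) x)).

Lemma conn_ext0 (nabla : connection) x :
  conn_ext nabla (mpure ((1 : A) : Omega 0) x) = nabla x.
Proof.
rewrite conn_ext_pure expr0 -mscaleE !scale1r.
have -> : diff ((1 : A) : Omega 0) = 0.
  apply/ffunP => u; rewrite !ffunE big_ord_recr big_ord1 /= !ffunE.
  by rewrite expr0 expr1 !mulr1 subrr.
have t0 : mpure (0 : Omega 1) x = 0.
  by apply: (addrI (mpure 0 x)); rewrite -[LHS]tpureDl !addr0.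
by rewrite t0 add0r.
Qed.

(* M_v = delta_v M, i.e. the fixed points of the idempotent    *)
(* delta_v = rho v, with its k-vector space structure                       *)
Definition delta (v : simp S 0) : A := rho k v.

Definition in_fiber v : {pred M} := fun x => delta v *: x == x.

Lemma in_fiberP v x : reflect (exists y, x = delta v *: y) (x \in in_fiber v).
Proof.
apply: (iffP eqP) => [xE|[y ->]]; first by exists x.
by rewrite scalerA rho_idem.
Qed.

Fact in_fiber_zmod_closed v : zmod_closed (in_fiber v).
Proof.
split; first by rewrite unfold_in scaler0.
by move=> x y /eqP xE /eqP yE; rewrite unfold_in scalerBr xE yE.
Qed.
HB.instance Definition _ v :=
  GRing.isZmodClosed.Build M (in_fiber v) (in_fiber_zmod_closed v).

Record fiber v := Fiber { fiber_val :> M; fiber_valP : fiber_val \in in_fiber v }.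
HB.instance Definition _ v := [isSub for @fiber_val v].
HB.instance Definition _ v := [Choice of fiber v by <:].
HB.instance Definition _ v := [SubChoice_isSubZmodule of fiber v by <:].

Fact fiber_scale_subproof v (c : k) (x : fiber v) :
  constf c *: (x : M) \in in_fiber v.
Proof.
rewrite unfold_in scalerA; have -> : delta v * constf c = constf c * delta v.
  by apply/ffunP => u; rewrite !ffunE mulrC.
by rewrite -scalerA (eqP (fiber_valP x)).
Qed.
Definition fiber_scale v (c : k) (x : fiber v) : fiber v :=
  Fiber (fiber_scale_subproof c x).

Let fiber_scaleA v c d (x : fiber v) :
  fiber_scale c (fiber_scale d x) = fiber_scale (c * d) x.
Proof.
apply: val_inj; rewrite /= scalerA; congr (_ *: _).
by apply/ffunP => u; rewrite !ffunE.
Qed.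
Let fiber_scale1 v : left_id 1 (@fiber_scale v).
Proof.
by move=> x; apply: val_inj; rewrite /= -[RHS]scale1r.
Qed.
Let fiber_scaleDr v : right_distributive (@fiber_scale v) +%R.
Proof. by move=> c x y; apply: val_inj; rewrite /= scalerDr. Qed.
Let fiber_scaleDl v x : {morph (@fiber_scale v)^~ x : c d / c + d}.
Proof.
move=> c d; apply: val_inj; rewrite /= -scalerDl; congr (_ *: _).
by apply/ffunP => u; rewrite !ffunE.
Qed.
HB.instance Definition _ v := GRing.Zmodule_isLmodule.Build k (fiber v)
  (@fiber_scaleA v) (@fiber_scale1 v) (@fiber_scaleDr v) (@fiber_scaleDl v).

Fact fiber_proj_subproof v x : delta v *: x \in in_fiber v.
Proof. by apply/in_fiberP; exists x. Qed.
(* x |-> delta_v x, with values in M_v *)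
Definition fiber_proj v (x : M) : fiber v := Fiber (fiber_proj_subproof v x).

Definition fiber_cast u v (e : u = v) (x : fiber u) : fiber v :=
  ecast w (fiber w) e x.

Lemma fiber_castE u v (e : u = v) (x : fiber u) : fiber_cast e x = x :> M.
Proof. by case: v / e. Qed.

(* Edges and transports: e goes from d_1 e to d_0 e. *)
Definition src (e : simp S 1) : simp S 0 := face S ord_max e.
Definition tgt (e : simp S 1) : simp S 0 := face S ord0 e.

Definition edge_maps := forall e : simp S 1, {linear fiber (src e) -> fiber (tgt e)}.

Definition edge_transports (nabla : connection) (R : edge_maps) : Prop :=
  forall x, nabla x = \sum_(e : simp S 1)
    mpure (rho k e) (fiber_proj (tgt e) x - R e (fiber_proj (src e) x) : fiber (tgt e)).

(* For s = [v_0, v_1, v_2]: the vertices v_i and the edges [v_i, v_j] *)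
Definition vert p (s : simp S p) (i : nat) : simp S 0 :=
  nth (vfirst s) (verts s) i.

Definition e01 (s : simp S 2) : simp S 1 := face S (inord 2) s.
Definition e02 (s : simp S 2) : simp S 1 := face S (inord 1) s.
Definition e12 (s : simp S 2) : simp S 1 := face S (inord 0) s.

Lemma src_vert e : src e = vert e 0. Proof. by []. Qed.
Lemma tgt_vert e : tgt e = vert e 1. Proof. by []. Qed.

Let vert_face (s : simp S 2) (j i : nat) : (j < 3)%N -> (i < 2)%N ->
  vert (face S (inord j) s) i = vert s (bump j i).
Proof.
move=> j3 i2; rewrite /vert verts_face inordK //.
move: (size_verts s) j3 i2; case: (verts s) => [|a [|b [|c []]]] //= _.
by case: j => [|[|[|]]]; case: i => [|[|]].
Qed.

Lemma src_e01 s : vert s 0 = src (e01 s).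
Proof. by rewrite src_vert vert_face. Qed.
Lemma tgt_e01 s : tgt (e01 s) = vert s 1.
Proof. by rewrite tgt_vert vert_face. Qed.
Lemma src_e02 s : vert s 0 = src (e02 s).
Proof. by rewrite src_vert vert_face. Qed.
Lemma tgt_e02 s : tgt (e02 s) = vert s 2.
Proof. by rewrite tgt_vert vert_face. Qed.
Lemma src_e12 s : vert s 1 = src (e12 s).
Proof. by rewrite src_vert vert_face. Qed.
Lemma tgt_e12 s : tgt (e12 s) = vert s 2.
Proof. by rewrite tgt_vert vert_face. Qed.

(* R_e with its source and target retyped along equalities of vertices *)
Definition retype (R : edge_maps) e u v (eu : u = src e) (ev : tgt e = v)
    (x : fiber u) : fiber v :=
  fiber_cast ev (R e (fiber_cast eu x)).

Definition R01 R s : fiber (vert s 0) -> fiber (vert s 1) :=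
  retype R (src_e01 s) (tgt_e01 s).
Definition R02 R s : fiber (vert s 0) -> fiber (vert s 2) :=
  retype R (src_e02 s) (tgt_e02 s).
Definition R12 R s : fiber (vert s 1) -> fiber (vert s 2) :=
  retype R (src_e12 s) (tgt_e12 s).

Definition triangle_maps :=
  forall s : simp S 2, {linear fiber (vert s 0) -> fiber (vert s 2)}.

(* U is the family corresponding to K : M -> Omega^2 (x) M. *)
Definition components (K : M -> mform 2) (U : triangle_maps) : Prop :=
  forall x, K x = \sum_(s : simp S 2)
    mpure (rho k s) (U s (fiber_proj (vert s 0) x) : fiber (vert s 2)).

End Connections.

(* Main.v *)
Require Import Defs.
From mathcomp Require Import all_boot all_order all_algebra.

Set Implicit Arguments.
Unset Strict Implicit.
Unset Printing Implicit Defensive.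

Import GRing.Theory.
Local Open Scope ring_scope.

(* Applying the extension to [nabla x = sum_e rho_e (x) Y_e], where
   [Y_e = delta_(tgt e) x - R_e x], the coefficient of [rho_s] is
   [Y_12 - Y_02 + Y_01] from the differential minus
   [delta_(v_2) Y_01 - R_12 Y_01] from the product. By balancing,
   [rho_s (x) delta_(v_2) Y_01 = rho_s (x) Y_01], so what remains is
   [Y_12 - Y_02 + R_12 Y_01], in which the terms [delta_(v_2) x] and
   [R_12 x] cancel. *)

Section ModuleForms.
Variables (k : fieldType) (n : nat) (S : ssns n).
Variable M : lmodType (vertex_alg k S).
Implicit Types (x y : M).

Lemma constfD (c d : k) : constf S (c + d) = constf S c + constf S d.
Proof. by apply/ffunP => u; rewrite !ffunE. Qed.

Lemma constf1 : constf S (1 : k) = 1.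
Proof. by apply/ffunP => u; rewrite !ffunE. Qed.

Lemma constf0 : constf S (0 : k) = 0.
Proof. by apply/ffunP => u; rewrite !ffunE. Qed.

Lemma constfM (c d : k) : constf S (c * d) = constf S c * constf S d.
Proof. by apply/ffunP => u; rewrite !ffunE. Qed.

Lemma constfN (c : k) : constf S (- c) = - constf S c.
Proof. by apply/ffunP => u; rewrite !ffunE. Qed.

Lemma mpureDl p (a b : Omega k S p) x : mpure (a + b) x = mpure a x + mpure b x.
Proof. exact: tpureDl. Qed.

Lemma mpureDr p (a : Omega k S p) x y : mpure a (x + y) = mpure a x + mpure a y.
Proof. exact: tpureDr. Qed.

Lemma mpure0l p x : mpure (0 : Omega k S p) x = 0.
Proof. by apply: (addrI (mpure 0 x)); rewrite -mpureDl !addr0. Qed.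

Lemma mpure0r p (a : Omega k S p) : mpure a (0 : M) = 0.
Proof. by apply: (addrI (mpure a 0)); rewrite -mpureDr !addr0. Qed.

Lemma mpureBr p (a : Omega k S p) x y : mpure a (x - y) = mpure a x - mpure a y.
Proof. by apply: (addIr (mpure a y)); rewrite -mpureDr !subrK. Qed.

Lemma mpure_suml p (I : finType) (a : I -> Omega k S p) x :
  mpure (\sum_i a i) x = \sum_i mpure (a i) x.
Proof.
by apply: (big_morph (fun b => mpure b x)) => [b c|]; rewrite ?mpureDl ?mpure0l.
Qed.

Lemma mpure_sumr p (I : finType) (a : Omega k S p) (y : I -> M) :
  mpure a (\sum_i y i) = \sum_i mpure a (y i).
Proof. by apply: big_morph => [b c|]; rewrite ?mpureDr ?mpure0r. Qed.

(** [rho k s] is fixed by right multiplication by the idempotent of its last vertex, and balancing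
    moves that idempotent across the tensor. *)
Lemma mpure_delta p (s : simp S p) x :
  mpure (rho k s) (delta k (vlast s) *: x) = mpure (rho k s) x.
Proof.
rewrite /mpure -tpureM rmulE; congr (tpure _ x); apply/ffunP => u.
rewrite wedge0rE !ffunE; have [->|_] := eqVneq u s; last by rewrite mul0r.
by rewrite eqxx mulr1.
Qed.

(** Right multiplication by a constant function is scaling, so the coefficients of [a] can be moved
    across the tensor; sums of forms can then be compared simplex by simplex. *)
Lemma mpure_basis p (a : Omega k S p) x :
  mpure a x = \sum_s mpure (rho k s) (constf S (a s) *: x).
Proof.
have {1}-> : a = \sum_s rmul (rho k s) (constf S (a s)).
  apply/ffunP => u; rewrite sum_ffunE (bigD1 u) //= rmulE wedge0rE !ffunE.
  rewrite eqxx mul1r big1 ?addr0 // => s nsu.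
  by rewrite rmulE wedge0rE ffunE eq_sym (negPf nsu) mul0r.
by rewrite mpure_suml; apply: eq_bigr => s _; apply: tpureM.
Qed.

Lemma scale_eq_sum (I : finType) (i0 : I) (y : I -> M) :
  \sum_i constf S ((i0 == i)%:R : k) *: y i = y i0.
Proof.
rewrite (bigD1 i0) //= eqxx constf1 scale1r big1 ?addr0 // => i ni.
by rewrite eq_sym (negPf ni) constf0 scale0r.
Qed.

(* The coefficient of [rho_s] is only determined after projection onto the
   fiber over the last vertex of [s]. *)
Definition mcoef p (s : simp S p) (t : mform M p) : M :=
  tlift (fun (a : Omega k S p) x => constf S (a s) *: (delta k (vlast s) *: x)) t.

Section Mcoef.
Variables (p : nat) (s : simp S p).
Let g (a : Omega k S p) x := constf S (a s) *: (delta k (vlast s) *: x).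
Let gDl x : {morph g^~ x : a b / a + b}.
Proof. by move=> a b; rewrite /g ffunE constfD scalerDl. Qed.
Let gDr a : {morph g a : x y / x + y}.
Proof. by move=> x y; rewrite /g !scalerDr. Qed.
(** Right multiplication by [f] scales the coefficient at [s] by the value of [f] at the last
    vertex, and that is also how [f] acts after projection by [delta k (vlast s)]. *)
Let gM a f x : g (rmul a f) x = g a (f *: x).
Proof.
rewrite /g !scalerA; congr (_ *: x); apply/ffunP => u.
rewrite rmulE wedge0rE !ffunE.
by have [->|_] := eqVneq u (vlast s); rewrite ?mulr0 ?mul0r ?mulr1.
Qed.

Lemma mcoef_pure a x :
  mcoef s (mpure a x) = constf S (a s) *: (delta k (vlast s) *: x).
Proof. exact: (tlift_pure gDl gDr gM). Qed.

Lemma mcoefB (t t' : mform M p) : mcoef s (t - t') = mcoef s t - mcoef s t'.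
Proof. exact: (tliftB gDl gDr gM). Qed.

Lemma mcoef0 : mcoef s (0 : mform M p) = 0.
Proof. by rewrite -(subrr 0) mcoefB subrr. Qed.

Lemma mcoefD (t t' : mform M p) : mcoef s (t + t') = mcoef s t + mcoef s t'.
Proof. by rewrite -[t' in LHS]opprK mcoefB -[- t']sub0r mcoefB mcoef0 sub0r opprK. Qed.
End Mcoef.

(** This gives uniqueness of components: a family with [T s] in the fiber over the last vertex is
    recovered from its sum. *)
Lemma mcoef_basis p (s : simp S p) (T : simp S p -> M) :
  mcoef s (\sum_u mpure (rho k u) (T u)) = delta k (vlast s) *: T s.
Proof.
rewrite (big_morph _ (mcoefD s) (mcoef0 s)).
under eq_bigr => u _ do rewrite mcoef_pure ffunE.
exact: (scale_eq_sum s (fun u => delta k (vlast s) *: T u)).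
Qed.

Section Curvature.
Variable nabla : connection M.

Lemma conn_extD p (s t : mform M p) :
  conn_ext nabla (s + t) = conn_ext nabla s + conn_ext nabla t.
Proof.
have e0 : conn_ext nabla (0 : mform M p) = 0.
  by rewrite -(subrr 0) conn_extB subrr.
by rewrite -[t in LHS]opprK conn_extB -[- t]sub0r conn_extB e0 sub0r opprK.
Qed.

Lemma conn_ext_sum p (I : finType) (t : I -> mform M p) :
  conn_ext nabla (\sum_i t i) = \sum_i conn_ext nabla (t i).
Proof.
apply: (big_morph _ (@conn_extD p)).
by rewrite -(subrr 0) conn_extB subrr.
Qed.

Variable R : edge_maps M.

(** Extending [R e] to all of [M] avoids casts between fibers over vertices that are only provably
    equal. *)
Definition transport (e : simp S 1) x : M := R e (fiber_proj (src e) x).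

Lemma transportB e x y : transport e (x - y) = transport e x - transport e y.
Proof.
rewrite /transport; have -> : fiber_proj (src e) (x - y) =
    fiber_proj (src e) x - fiber_proj (src e) y.
  by apply: val_inj; rewrite /= scalerBr.
by rewrite raddfB.
Qed.

Lemma transport_src e x : transport e (delta k (src e) *: x) = transport e x.
Proof.
rewrite /transport; congr (fiber_val (R e _)); apply: val_inj.
by rewrite /= scalerA rho_idem.
Qed.

(** Casts keep the underlying element of [M], and projecting to the source fixes an [x] already in
    that fiber. *)
Lemma retypeE e u v (eu : u = src e) (ev : tgt e = v) (x : fiber M u) :
  retype R eu ev x = transport e x :> M.
Proof.
rewrite fiber_castE /transport; congr (fiber_val (R e _)); apply: val_inj.
by rewrite /= fiber_castE -eu; apply/esym/eqP/fiber_valP.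
Qed.

Lemma last_edge_e12 (s : simp S 2) : last_edge s = e12 s.
Proof. by congr (face S _ s); apply: val_inj; rewrite /= inordK. Qed.

Lemma vlast_e12 (s : simp S 2) : vlast s = tgt (e12 s).
Proof. by rewrite -last_edge_e12. Qed.

Lemma face_max_e01 (s : simp S 2) : face S ord_max s = e01 s.
Proof. by congr (face S _ s); apply: val_inj; rewrite /= inordK. Qed.

Lemma sum_diff_rho (s : simp S 2) (y : simp S 1 -> M) :
  \sum_e constf S (diff (rho k e) s) *: y e = y (e12 s) - y (e02 s) + y (e01 s).
Proof.
rewrite -[y (e12 s)]scale_eq_sum -[y (e02 s)]scale_eq_sum -[y (e01 s)]scale_eq_sum.
rewrite -sumrN -!big_split; apply: eq_bigr => e _ /=.
rewrite -scaleNr -constfN -!scalerDl -!constfD; congr (constf S _ *: _).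
rewrite ffunE !big_ord_recr big_ord0 /= add0r !ffunE.
rewrite expr0 mul1r expr1 mulN1r expr2 mulN1r opprK mul1r.
(* Only the face indices remain to be matched: the ordinals from the sum against the [inord] in
   [e12], [e02], [e01]. *)
by do !congr (_ + _); rewrite ?[- _]opprK; do ?congr (- _);
   congr (nat_of_bool (face S _ s == e))%:R;
   apply: val_inj; rewrite /= inordK.
Qed.

Hypothesis nablaR : edge_transports nabla R.

Lemma edge_transportsE x :
  nabla x = \sum_e mpure (rho k e) (delta k (tgt e) *: x - transport e x).
Proof. exact: nablaR. Qed.

Lemma sum_mwedge_rho (y : simp S 1 -> M) :
  \sum_e mwedge 2 (rho k e) (nabla (y e)) =
  \sum_(s : simp S 2) mpure (rho k s)
    (y (e01 s) - transport (e12 s) (y (e01 s))).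
Proof.
under eq_bigr => e _.
  rewrite edge_transportsE (big_morph _ (mwedgeDr 2 (rho k e)) (mwedge0 M _ _ _)).
  under eq_bigr => f _ do rewrite mwedge_pure mpure_basis.
  rewrite exchange_big /=; over.
rewrite exchange_big /=; apply: eq_bigr => s _.
(* At [s], the product of [rho k e] and [rho k f] is the indicator of [e] being the front edge and
   [f] the last edge, so both sums collapse. *)
under eq_bigr => e _.
  under eq_bigr => f _ do rewrite wedge1rE !ffunE constfM -scalerA.
  rewrite -mpure_sumr -scaler_sumr scale_eq_sum; over.
rewrite -mpure_sumr scale_eq_sum last_edge_e12 face_max_e01.
by rewrite !mpureBr -vlast_e12 mpure_delta.
Qed.

Lemma curvatureE x :
  curvature nabla x =
  \sum_(s : simp S 2)
    mpure (rho k s) (transport (e02 s) x - transport (e12 s) (transport (e01 s) x)).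
Proof.
rewrite /curvature conn_ext0 edge_transportsE conn_ext_sum.
pose y e := delta k (tgt e) *: x - transport e x.
under eq_bigr => e _ do rewrite conn_ext_pure expr1 scaleN1r mpure_basis.
rewrite big_split /= sumrN (sum_mwedge_rho y) exchange_big -sumrB /=.
apply: eq_bigr => s _; rewrite -mpure_sumr (sum_diff_rho s y) -mpureBr.
congr (mpure _ _).
rewrite [- (y (e01 s) - _)]opprB addrC [_ + y (e01 s)]addrC subrKA /y transportB.
(* The target of [e01 s] is the source of [e12 s], so the projection left by [y (e01 s)] is absorbed
   by the transport along [e12 s]. *)
rewrite tgt_e01 src_e12 transport_src tgt_e12 tgt_e02 opprB.
by rewrite [_ - _ + (_ - delta _ _ *: _)]addrC subrKA addrC subrKA.
Qed.

End Curvature.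
End ModuleForms.

Theorem proposition5p10 (k : fieldType) (char_k : 2%N \notin [pchar k])
    (n : nat) (S : ssns n)
    (M : lmodType (vertex_alg k S)) (fdM : finite_dimensional M)
    (nabla : connection M) (R : edge_maps M)
    (nablaR : edge_transports nabla R) :
  (forall U : triangle_maps M, components (curvature nabla) U ->
     forall (s : simp S 2) (x : fiber M (vert s 0)),
       U s x = R02 R x - R12 R (R01 R x))
  /\
  (forall x : M, curvature nabla x =
     \sum_(s : simp S 2)
        mpure (rho k s)
          (R02 R (fiber_proj (vert s 0) x)
           - R12 R (R01 R (fiber_proj (vert s 0) x)))).
Proof.
have KE x : curvature nabla x = \sum_(s : simp S 2) mpure (rho k s)
    (R02 R (fiber_proj (vert s 0) x) - R12 R (R01 R (fiber_proj (vert s 0) x))).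
  rewrite (curvatureE nablaR); apply: eq_bigr => s _; congr (mpure _ _).
  (* The same vertex $v_0$ must be read as the source of [e02 s] in the first term and of [e01 s] in
     the second. *)
  by rewrite [RHS](raddfB \val) /= !retypeE /= {1}src_e02 src_e01 !transport_src.
split=> // U KU s x.
have xE : fiber_proj (vert s 0) (x : M) = x by exact/val_inj/eqP/fiber_valP.
have lastE (z : fiber M (vert s 2)) : delta k (vlast s) *: fiber_val z = fiber_val z.
  by rewrite vlast_e12 tgt_e12; apply/eqP/fiber_valP.
(* Both expansions have coefficients in the fiber over $v_2$, where [mcoef s] loses nothing. *)
move: (KE x); rewrite KU => /(congr1 (mcoef s)).
by rewrite !mcoef_basis !lastE xE => /val_inj.
Qed.
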